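(* Let $n\in\mathbb N$, let $\tau$ be an $S_0$-independent homomorphism from $S_n$ to $\mathbb N$, and let $B\subseteq\mathbb N$. The following statements are equivalent. (a) Whenever $S_0$ is finitely colored, there exists $w\in S_n$ such that $\{w(\vec x):\vec x\in\mathbb A^n\}$ is monochromatic and $\tau(w)\in B$. (b) Whenever $D$ is a piecewise syndetic subset of $S_0$, there exists $w\in S_n$ such that $\{w(\vec x):\vec x\in\mathbb A^n\}\subseteq D$ and $\tau(w)\in B$.
   Context: $\mathbb A$ is a fixed nonempty finite alphabet, $S_0=\mathbb A^+$ the free semigroup of nonempty words over $\mathbb A$, and $S_n$ the set of nonempty words over $\mathbb A\cup\{v_1,\dots,v_n\}$ (distinct variables not in $\mathbb A$) in which each $v_i$ occurs. For $\vec x\in\mathbb A^n$, $w(\vec x)$ replaces each occurrence of $v_i$ in $w$ by $x_i$. A homomorphism $\tau:S_n\to(\mathbb N,+)$ is $S_0$-independent if $\tau(uw)=\tau(w)=\tau(wu)$ for all $w\in S_n,u\in S_0$. A subset $D$ of $S_0$ is piecewise syndetic if $D\in p$ for some $p$ in the smallest two-sided ideal $K(\beta S_0)$ of the Stone–Čech compactification $\beta S_0$; equivalently, there is a finite $G\subseteq S_0$ such that for every finite $H\subseteq S_0$ there is $x\in S_0$ with $Hx\subseteq\bigcup_{t\in G}t^{-1}D$, where $t^{-1}D=\{y:ty\in D\}$. *)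

(* Defs.v *)
From HB Require Import structures.
From mathcomp Require Import all_boot.
From mathcomp Require Import boolp classical_sets filter.

Set Implicit Arguments.
Unset Strict Implicit.
Unset Printing Implicit Defensive.

Local Open Scope classical_set_scope.

(* The points of beta T, T discrete, are the ultrafilters on T. *)
Record beta (T : Type) : Type :=
  Beta { beta_sets :> set T -> Prop; beta_ultra : UltraFilter beta_sets }.
#[global] Existing Instance beta_ultra.

HB.instance Definition _ (T : Type) := gen_eqMixin (beta T).
HB.instance Definition _ (T : Type) := gen_choiceMixin (beta T).

Lemma beta_eq (T : Type) (p q : beta T) :
  (forall D, p D <-> q D) -> p = q.
Proof.
move: p q => [p up] [q uq] /= pq.
have E : p = q by apply/funext => D; apply/propext.
by move: uq; rewrite -E => uq; congr Beta; exact: Prop_irrelevance.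
Qed.

Lemma setC_ultra (T : Type) (F : set_system T) :
  ProperFilter F -> (forall D, F D \/ F (~` D)) -> UltraFilter F.
Proof.
move=> PF FC; split=> // G PG FG; apply/seteqP; split=> // D GD.
have [//|/FG GCD] := FC D.
by have [x []] := filter_ex (filterI GD GCD).
Qed.

Section BetaMul.
Variable S : semigroupType.

(* D belongs to p * q iff {x | x^-1 D \in q} belongs to p, where
   x^-1 D = {y | x * y \in D}; with this convention beta S is right
   topological: p |-> p * q is continuous. *)
Definition beta_mul_sets (p q : beta S) : set_system S :=
  [set D | p [set x | q [set y | D (x * y)%g]]].

Lemma beta_mul_ultra (p q : beta S) : UltraFilter (beta_mul_sets p q).
Proof.
apply: setC_ultra; last first.
  move=> D; rewrite /beta_mul_sets /=.
  have [|pC] := in_ultra_setVsetC [set x | q [set y | D (x * y)%g]]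
    (beta_ultra p); first by left.
  right; apply: filterS pC => x /= nqx.
  by have [|//] := in_ultra_setVsetC [set y | D (x * y)%g] (beta_ultra q).
apply: Build_ProperFilter_ex => [D pqD|].
  have [x qx] := @filter_ex _ p _ _ pqD.
  by have [y Dxy] := @filter_ex _ q _ _ qx; exists (x * y)%g.
have Fp : Filter p by exact: filter_filter.
have Fq : Filter q by exact: filter_filter.
split=> [|D E pD pE|D E DE pD].
- apply: (@filterS _ p Fp setT) => [x _|]; last exact: (@filterT _ p Fp).
  exact: (@filterT _ q Fq).
- apply: (@filterS _ p Fp _ _ _ (@filterI _ p Fp _ _ pD pE)) => x [qD qE].
  exact: (@filterI _ q Fq _ _ qD qE).
- apply: (@filterS _ p Fp _ _ _ pD) => x; apply: (@filterS _ q Fq) => y.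
  exact: DE.
Qed.

Definition beta_mul (p q : beta S) : beta S := Beta (beta_mul_ultra p q).

Lemma beta_mulA : associative beta_mul.
Proof.
move=> p q r; apply: beta_eq => D; rewrite /= /beta_mul_sets /=.
suff -> : [set x | q [set y | r [set z | D (x * (y * z))%g]]] =
  [set x | q [set y | r [set z | D (x * y * z)%g]]] by [].
apply/funext => x /=; congr (q _); apply/funext => y /=.
by congr (r _); apply/funext => z /=; rewrite monoid.mulgA.
Qed.

HB.instance Definition _ := isSemigroup.Build (beta S) beta_mulA.

End BetaMul.

Definition two_sided_ideal (T : semigroupType) (I : set T) : Prop :=
  I !=set0 /\ forall t x, I x -> I (t * x)%g /\ I (x * t)%g.

(* The intersection of all two-sided ideals; for T = beta S this is K(beta S). *)
Definition smallest_ideal (T : semigroupType) : set T :=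
  smallest (@two_sided_ideal T) set0.

Definition piecewise_syndetic (S : semigroupType) (D : set S) : Prop :=
  exists2 p : beta S, smallest_ideal p & p D.

(* word A is the free semigroup S_0; vword A n is S_n. *)

Section Words.
Variable A : finType.

Record word : Type := Word { word_seq :> seq A; _ : word_seq != [::] }.
HB.instance Definition _ := [isSub for word_seq].
HB.instance Definition _ := [Choice of word by <:].

Lemma word_mul_subproof (u v : word) : u ++ v != [::].
Proof. by case: u => -[]. Qed.

Definition word_mul (u v : word) : word := Word (word_mul_subproof u v).

Lemma word_mulA : associative word_mul.
Proof. by move=> u v w; apply: val_inj; rewrite /= catA. Qed.

HB.instance Definition _ := isSemigroup.Build word word_mulA.

Variable n : nat.

(* The letter a is [inl a], the variable v_i is [inr i]. *)
Definition is_vword (s : seq (A + 'I_n)) : bool :=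
  (s != [::]) && [forall i, inr i \in s].

Record vword : Type :=
  VWord { vword_seq :> seq (A + 'I_n); _ : is_vword vword_seq }.
HB.instance Definition _ := [isSub for vword_seq].
HB.instance Definition _ := [Choice of vword by <:].

Lemma is_vword_catl (s : seq (A + 'I_n)) (w : vword) : is_vword (s ++ w).
Proof.
case: w => w /= /andP[w0 /forallP wv]; apply/andP; split.
  by rewrite -size_eq0 size_cat addn_eq0 negb_and !size_eq0 w0 orbT.
by apply/forallP => i; rewrite mem_cat wv orbT.
Qed.

Lemma is_vword_catr (w : vword) (s : seq (A + 'I_n)) : is_vword (w ++ s).
Proof.
case: w => w /= /andP[w0 /forallP wv]; apply/andP; split.
  by rewrite -size_eq0 size_cat addn_eq0 negb_and !size_eq0 w0.
by apply/forallP => i; rewrite mem_cat wv.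
Qed.

Definition vword_mul (v w : vword) : vword := VWord (is_vword_catl v w).

Lemma vword_mulA : associative vword_mul.
Proof. by move=> u v w; apply: val_inj; rewrite /= catA. Qed.

HB.instance Definition _ := isSemigroup.Build vword vword_mulA.

Definition lcat (u : word) (w : vword) : vword :=
  VWord (is_vword_catl (map inl u) w).
Definition rcat (w : vword) (u : word) : vword :=
  VWord (is_vword_catr w (map inl u)).

Definition S0_independent (tau : vword -> nat) : Prop :=
  forall (w : vword) (u : word), tau (lcat u w) = tau w /\ tau w = tau (rcat w u).

Definition subst_letter (x : n.-tuple A) (l : A + 'I_n) : A :=
  match l with inl a => a | inr i => tnth x i end.

Lemma subst_subproof (w : vword) (x : n.-tuple A) :
  map (subst_letter x) w != [::].
Proof. by case: w => -[]. Qed.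

Definition subst (w : vword) (x : n.-tuple A) : word :=
  Word (subst_subproof w x).

Definition instances (w : vword) : set word := [set subst w x | x in setT].

End Words.

Definition monochromatic (T C : Type) (c : T -> C) (X : set T) : Prop :=
  exists i : C, forall x, X x -> c x = i.

(* Main.v *)
Require Import Defs.
From mathcomp Require Import all_boot.
From mathcomp Require Import boolp classical_sets filter.

(** Call a set of words good if it contains all the instances of
    some [w] with [tau w] in [B].

    If (a) holds, then some ultrafilter consists of good sets only. The set of
    all such ultrafilters is a two-sided ideal: if [x^-1 D] is good through [w],
    then [D] is good through [x w], whereas a finite intersection of the sets
    [x^-1 D], [x] an instance of [w], has an element [u], and then [D] is good
    through [w u]; independence gives [tau (x w) = tau w = tau (w u)]. Hence this
    ideal contains the smallest ideal, which is (b).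

    Conversely, one of the colour classes belongs to a given point of the
    smallest ideal, so that it suffices to show that this ideal is not empty.
    The nonempty closed left ideals of beta S are the sets
    of ultrafilters refining a left invariant proper filter. By Zorn's lemma
    there is a maximal such filter, and every ultrafilter [q] refining it
    satisfies [q = t * (r * q)], with [t] depending on [r], for every [r]; thus
    [q] belongs to all two-sided ideals. *)

Set Implicit Arguments.
Unset Strict Implicit.
Unset Printing Implicit Defensive.

Local Open Scope classical_set_scope.

Lemma beta_exists (T : Type) (F : set_system T) :
  ProperFilter F -> exists q : beta T, F `<=` q.
Proof.
by move=> /ultraFilterLemma[G [uG FG]]; exists (Beta uG).
Qed.

Lemma sub_beta_eq (T : Type) (p q : beta T) : p `<=` q -> p = q.
Proof.
move=> pq; apply: beta_eq => D.
by rewrite (max_filter (UltraFilter := beta_ultra p) (ultra_proper) pq).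
Qed.

Lemma beta_color (T : Type) (p : beta T) (C : finType) (c : T -> C) :
  exists i, p [set x | c x = i].
Proof.
apply: contrapT => /forallNP pc.
have : p [set x | forall i, c x <> i].
  apply: filter_forall => i.
  by have [/pc|] := in_ultra_setVsetC [set x | c x = i] (beta_ultra p).
by move=> /filter_ex[x /(_ (c x))].
Qed.

(** Compactness: the sets containing every class in [P] of some finite colouring form a proper
    filter, and any [q] refining it works. If [D] is not in [P], colouring by membership in [D] puts
    its complement in the filter. *)
Lemma beta_partition_regular (T : Type) (P : set (set T)) :
  (forall D, P D -> D !=set0) ->
  (forall D E, D `<=` E -> P D -> P E) ->
  (forall k (c : T -> 'I_k), exists i, P [set x | c x = i]) ->
  exists q : beta T, q `<=` P.
Proof.
move=> P0 PS Pc.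
have {}Pc (C : finType) (c : T -> C) : exists i, P [set x | c x = i].
  have [i Pi] := Pc _ (fun x => enum_rank (c x)).
  by exists (enum_val i); apply: PS Pi => x /= <-; rewrite enum_rankK.
pose F : set_system T := [set D | exists (C : finType) (c : T -> C),
  forall i, P [set x | c x = i] -> [set x | c x = i] `<=` D].
have PF : ProperFilter F.
  apply: Build_ProperFilter_ex => [D [C [c cD]]|].
    have [i Pi] := Pc _ c; have [x cx] := P0 _ Pi.
    by exists x; exact: (cD i Pi).
  split=> [|D E [C [c cD]] [C' [c' cE]]|D E DE [C [c cD]]].
  - by exists unit, (fun=> tt).
  - exists (C * C')%type, (fun x => (c x, c' x)) => -[i j] Pij x /= [cx c'x].
    split; first by apply: (cD i) => //; apply: PS Pij => y [].
    by apply: (cE j) => //; apply: PS Pij => y [].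
  - by exists C, c => i Pi x cx; apply/DE/(cD i).
have [q Fq] := beta_exists PF; exists q => D qD; apply: contrapT => PD.
have /Fq qCD : F (~` D).
  exists bool, (fun x => `[< D x >]) => -[] Pi x /= xD.
    by case: PD; apply: PS Pi => y /asboolP.
  by apply/asboolP; rewrite asbool_neg xD.
by have [x []] := filter_ex (filterI qD qCD).
Qed.

Section SmallestIdeal.
Variable S : semigroupType.

Definition left_invariant (F : set_system S) : Prop :=
  forall x D, F D -> F [set y | D (x * y)%g].

Lemma maximal_left_invariant_filter (x0 : S) :
  exists F : set_system S, [/\ ProperFilter F, left_invariant F &
    forall G, ProperFilter G -> left_invariant G -> F `<=` G -> G = F].
Proof.
pose Q (F : set_system S) := ProperFilter F /\ left_invariant F.
have [Fs FsQ totFs|F [QF maxF]] :=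
    @Zorn_bigcup (set S) [set F | F = set0 \/ Q F].
  have [[F0 FsF0 [PF0 _]]|noF] := pselect (exists2 F, Fs F & Q F); last first.
    left; apply/seteqP; split=> // D [F FsF FD].
    by case: (FsQ _ FsF) FD => [->|QF] //; case: noF; exists F.
  right; have Q_mem F D : Fs F -> F D -> Q F.
    by move=> FsF FD; case: (FsQ _ FsF) FD => [->|].
  split; last first.
    move=> x D [F FsF FD]; exists F => //.
    by have [_] := Q_mem _ _ FsF FD; exact.
  apply: Build_ProperFilter_ex => [D [F FsF FD]|].
    by have [PF _] := Q_mem _ _ FsF FD; exact: filter_ex FD.
  split=> [|D E [F FsF FD] [G FsG GE]|D E DE [F FsF FD]].
  - by exists F0 => //; exact: filterT.
  - have [FG|GF] := totFs _ _ FsF FsG.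
      have [PG _] := Q_mem _ _ FsG GE.
      by exists G => //; apply: filterI => //; exact: FG.
    have [PF _] := Q_mem _ _ FsF FD.
    by exists F => //; apply: filterI => //; exact: GF.
  - have [PF _] := Q_mem _ _ FsF FD.
    by exists F => //; exact: filterS FD.
(* The filter [[set setT]] properly extends [set0], which is thus not maximal. *)
have {}QF : Q F.
  case: QF => // F0; exfalso; apply: (maxF [set setT]).
    by rewrite F0; split=> // /(_ setT erefl).
  right; split; last by move=> x D ->.
  by apply: Build_ProperFilter_ex => D ->; exists x0.
have [PF IF] := QF; exists F; split=> // G PG IG FG.
apply/seteqP; split=> //; apply: contrapT => GF.
by apply: (maxF G) => //; right.
Qed.

Lemma smallest_ideal_nonempty (x0 : S) :
  exists p : beta S, smallest_ideal p.
Proof.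
have [F [PF IF maxF]] := maximal_left_invariant_filter x0.
have [q Fq] := beta_exists PF.
exists q => I /= [[[r Ir] idI] _].
(* The intersection of the ultrafilters [s * (r * q)], [s] in [S]: a left invariant proper filter
   containing [F], hence equal to [F]. *)
pose G : set_system S := [set D | forall s, (r * q)%g [set y | D (s * y)%g]].
have GE : G = F.
  apply: maxF => [|x D GD s|D FD s].
  - apply: Build_ProperFilter_ex => [D /(_ x0)/filter_ex[y Dy]|].
      by exists (x0 * y)%g.
    split=> [s|D E GD GE s|D E DE GD s]; first exact: filterT.
      exact: filterI (GD s) (GE s).
    by apply: filterS (GD s) => y; exact: DE.
  - apply: filterS (GD (x * s)%g) => y /=.
    by rewrite monoid.mulgA.
  - apply: (@filterS _ r _ setT) => [x _|]; last exact: filterT.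
    exact/Fq/IF/IF.
(* A point [t] containing [B D] for all [D] in [q] satisfies [t * (r * q) = q]. An empty [B D] would
   put the complement of [D] in [G = F], hence in [q]. *)
pose B (D : set S) := [set s | (r * q)%g [set y | D (s * y)%g]].
have PB : ProperFilter (filter_from q B).
  apply: filter_from_proper => [|D qD].
    apply: filter_from_filter => [|D E qD qE].
      by exists setT; exact: filterT.
    exists (D `&` E); first exact: filterI.
    by move=> s Bs; split; apply: filterS Bs => y [].
  apply: contrapT => BD0.
  have : G (~` D).
    move=> s; have [BDs|//] := in_ultra_setVsetC
      [set y | D (s * y)%g] (beta_ultra (r * q)%g).
    by case: BD0; exists s.
  rewrite GE => /Fq qCD.
  by have [x []] := filter_ex (filterI qD qCD).
have [t Bt] := beta_exists PB.
have <- : (t * (r * q))%g = q.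
  by apply/esym/sub_beta_eq => D qD; apply: Bt; exists D.
by apply: (idI _ _ _).1; exact: (idI _ _ Ir).2.
Qed.

End SmallestIdeal.

Section VariableWords.
Variables (A : finType) (n : nat).

Lemma subst_lcat (u : word A) (w : vword A n) x :
  subst (lcat u w) x = (u * subst w x)%g.
Proof.
by apply: val_inj; rewrite /= map_cat -map_comp map_id.
Qed.

Lemma subst_rcat (w : vword A n) (u : word A) x :
  subst (rcat w u) x = (subst w x * u)%g.
Proof.
by apply: val_inj; rewrite /= map_cat -map_comp map_id.
Qed.

Variables (tau : vword A n -> nat) (B : set nat).
Hypothesis tau_indep : S0_independent tau.

Definition good (D : set (word A)) : Prop :=
  exists w : vword A n, instances w `<=` D /\ B (tau w).

Lemma good_two_sided_ideal (q0 : beta (word A)) : q0 `<=` good ->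
  two_sided_ideal [set q : beta (word A) | q `<=` good].
Proof.
move=> q0good; split; first by exists q0.
move=> t q qgood; split=> D /=.
  move=> /(@filter_ex _ t)[u /qgood[w [wD Bw]]].
  exists (lcat u w); split; last by rewrite (tau_indep w u).1.
  by move=> _ [x _ <-]; rewrite subst_lcat; apply: wD; exists x.
(* Goodness is applied to the set of [x] with x^-1 D in [t], which belongs to [q] since [D] belongs
   to [q * t]. *)
move=> /qgood[w [wD Bw]].
have : t [set u | forall x, D (subst w x * u)%g].
  by apply: filter_forall => x; apply: wD; exists x.
move=> /filter_ex[u wuD].
exists (rcat w u); split; last by rewrite -(tau_indep w u).2.
by move=> _ [x _ <-]; rewrite subst_rcat.
Qed.

End VariableWords.

Unset Implicit Arguments.
Local Close Scope classical_set_scope.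

Theorem theorem4p7 (A : finType) (A_nonempty : (0 < #|A|)%N) (n : nat)
  (tau : vword A n -> nat)
  (tau_hom : forall v w : vword A n, tau (v * w)%g = (tau v + tau w)%N)
  (tau_indep : S0_independent tau)
  (B : set nat) :
  (forall (k : nat) (c : word A -> 'I_k),
     exists w : vword A n, monochromatic c (instances w) /\ B (tau w))
  <->
  (forall D : set (word A), piecewise_syndetic D ->
     exists w : vword A n, (instances w `<=` D)%classic /\ B (tau w)).
Proof.
(* The letter [a] yields a tuple to substitute, so that good sets are nonempty, and an element
   [[:: a]] of the semigroup. *)
have [a _] := card_gt0P A_nonempty.
split=> [colB D [p Kp pD]|psB k c].
  have [|D' E DE [w [wD Bw]]|k c|q0 q0good] :=
      @beta_partition_regular _ (good tau B).
  - move=> D' [w [wD _]]; exists (subst w [tuple of nseq n a]).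
    by apply: wD; exists [tuple of nseq n a].
  - by exists w; split=> // u /wD/DE.
  - have [w [[i wi] Bw]] := colB k c.
    by exists i, w.
  - exact: (Kp _ (conj (good_two_sided_ideal tau_indep q0good) (@sub0set _ _))).
have [p Kp] := smallest_ideal_nonempty (@Word A [:: a] isT).
have [i pi] := beta_color p c.
have [w [wi Bw]] := psB _ (ex_intro2 _ _ p Kp pi).
by exists w; split=> //; exists i.
Qed.
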